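(* The maximum number of real mutually unbiased weighing matrices of order $8$ and weight $4$ is $14$; that is, there exists a set of $14$ mutually unbiased real weighing matrices of order $8$ and weight $4$, and every set of mutually unbiased real weighing matrices of order $8$ and weight $4$ has at most $14$ elements.
   Context: A unit weighing matrix of order $n$ and weight $w$ is an $n\times n$ complex matrix $W$ all of whose entries have absolute value $0$ or $1$ and which satisfies $WW^*=wI_n$, where $W^*$ is the conjugate transpose. A real weighing matrix is a unit weighing matrix with all entries in $\{0,1,-1\}$. Two weighing matrices $H,K$ of order $n$ and weight $w$ are unbiased if $HK^*=\sqrt{w}\,L$ for some unit weighing matrix $L$ of order $n$ and weight $w$. A set of weighing matrices of the same order and weight is mutually unbiased if any two distinct members are unbiased. *)

(* Defs.v *)
From HB Require Import structures.
From mathcomp Require Import all_boot all_order all_algebra.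
From mathcomp Require Import classical_sets cardinality reals.
From mathcomp Require Import complex.

Set Implicit Arguments.
Unset Strict Implicit.
Unset Printing Implicit Defensive.

Import Order.TTheory GRing.Theory Num.Theory.

Local Open Scope ring_scope.
Local Open Scope sesquilinear_scope.

(* [M ^t*] is the library's conjugate transpose (sesquilinear_scope). *)

Definition unit_weighing (C : numClosedFieldType) (n w : nat) (W : 'M[C]_n) : Prop :=
  (forall i j, `|W i j| = 0 \/ `|W i j| = 1) /\ W *m W ^t* = (w%:R)%:M.

Definition real_weighing (C : numClosedFieldType) (n w : nat) (W : 'M[C]_n) : Prop :=
  unit_weighing w W /\ (forall i j, [\/ W i j = 0, W i j = 1 | W i j = -1]).

(* The matrix [L] is only required to be a unit weighing matrix, even when
   [H] and [K] are real. *)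
Definition unbiased (C : numClosedFieldType) (n w : nat) (H K : 'M[C]_n) : Prop :=
  exists L : 'M[C]_n, unit_weighing w L /\ H *m K ^t* = sqrtC (w%:R) *: L.

Definition mutually_unbiased_real (C : numClosedFieldType) (n w : nat)
    (S : set 'M[C]_n) : Prop :=
  (forall H, S H -> real_weighing w H) /\
  (forall H K, S H -> S K -> H <> K -> unbiased w H K).

(* Main.v *)
Require Import Defs.
From mathcomp Require Import all_boot all_order all_algebra.
From mathcomp Require Import classical_sets cardinality reals.
From mathcomp Require Import complex.
From mathcomp Require Import boolp finmap zify ring.

(** The rows of real mutually unbiased weighing matrices of order 8 and weight
    4 are vectors of squared length 4 whose inner products lie in
    {0, 2, -2, 4}: up to scale they are roots of the E8 lattice, and each matrix
    is a frame, that is, an orthogonal basis of roots.  E8 has 120 pairs of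
    opposite roots, hence room for at most 15 disjoint frames.  The bound is 14
    rather than 15 because the basis of the vectors [2 e_i] is one more frame:
    its inner products with the rows are twice the entries, hence 0, 2 or -2, so
    it is unbiased to every weighing matrix without being one.

    The count of roots is replaced by a fourth-moment inequality
    ([fourth_moment_bound]), valid for all families of real vectors in dimension
    [n]:
      3 (sum_i |x_i|^4)^2 <= n (n + 2) sum_(i, j) <x_i, x_j>^4.
    It says that the tensor [T = sum_i x_i^(tensor 4)] minus its orthogonal
    projection on the line spanned by the rotation-invariant symmetric tensor
    [pairings] has nonnegative square norm.  For [N] pairwise unbiased frames of
    vectors of squared length [w], both sides are known exactly: between two
    frames [<x_i, x_j>^4] sums to [n w^3], since the inner products are
    [sqrt w] times the entries of a weighing matrix.  The inequality becomes
    [3 w N <= (n + 2)(w + N - 1)] ([frame_bound]).  With the basis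
    [sqrt w e_i] added to the matrices (so [N = k + 1]), [n = 8] and [w = 4]
    give [k <= 14].

    Conversely, the roots other than the [2 e_i] are supported on the 14 affine
    planes of F_2^3, with arbitrary signs.  The 16 sign patterns on a plane
    form, up to sign, two orthogonal bases, with an even and with an odd number of
    minus signs.  Each of the 7 pairs of parallel planes and each parity thus
    give one weighing matrix, and these 14 matrices are mutually unbiased
    ([e8_mx_unbiased]): on a common plane, opposite parities give inner products
    2 or -2, and non-parallel planes meet in two points, so that the inner
    product is a sum of two signs. *)
Set Implicit Arguments.
Unset Strict Implicit.
Unset Printing Implicit Defensive.

Import Order.TTheory GRing.Theory Num.Theory.
Local Open Scope ring_scope.
Local Open Scope sesquilinear_scope.
Local Open Scope classical_set_scope.
Local Open Scope card_scope.

(** * Fourth-order tensors *)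

Definition dot (R : nzRingType) (n : nat) (x y : 'I_n -> R) : R :=
  \sum_a x a * y a.

Local Notation tensor4 R n := ('I_n -> 'I_n -> 'I_n -> 'I_n -> R).

Definition sum4 (R : nzRingType) (n : nat) (t : tensor4 R n) : R :=
  \sum_a \sum_b \sum_c \sum_d t a b c d.

(** Up to the factor 3, the rotation-invariant symmetric tensor of order four,
    i.e. the polarization of [|u|^4]. *)
Definition pairings (R : nzRingType) (n : nat) (a b c d : 'I_n) : R :=
  (a == b)%:R * (c == d)%:R + (a == c)%:R * (b == d)%:R
  + (a == d)%:R * (b == c)%:R.

Lemma eq_sum4 (R : nzRingType) (n : nat) (s t : tensor4 R n) :
  (forall a b c d, s a b c d = t a b c d) -> sum4 s = sum4 t.
Proof.
by move=> st; do 4![apply: eq_bigr => ? _]; apply: st.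
Qed.

Lemma sum4D (R : nzRingType) (n : nat) (s t : tensor4 R n) :
  sum4 (fun a b c d => s a b c d + t a b c d) = sum4 s + sum4 t.
Proof.
rewrite /sum4 -big_split; apply: eq_bigr => a _.
rewrite -big_split; apply: eq_bigr => b _.
by rewrite -big_split; apply: eq_bigr => c _; rewrite -big_split.
Qed.

Lemma sum4Z (R : nzRingType) (n : nat) k (t : tensor4 R n) :
  sum4 (fun a b c d => k * t a b c d) = k * sum4 t.
Proof. by rewrite /sum4; do 4![rewrite mulr_sumr; apply: eq_bigr => ? _]. Qed.

Lemma exchange_sum4 (R : nzRingType) (n : nat) (I : finType)
    (t : I -> tensor4 R n) :
  sum4 (fun a b c d => \sum_i t i a b c d) = \sum_i sum4 (t i).
Proof.
rewrite /sum4 [RHS]exchange_big; apply: eq_bigr => a _.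
rewrite [RHS]exchange_big; apply: eq_bigr => b _.
rewrite [RHS]exchange_big; apply: eq_bigr => c _.
exact: exchange_big.
Qed.

Lemma sum4_rank_one (R : comNzRingType) (n : nat) (u : 'I_n -> R) :
  sum4 (fun a b c d => u a * u b * u c * u d) = (\sum_a u a) ^+ 4.
Proof.
rewrite /sum4; under eq_bigr => a _.
  under eq_bigr => b _.
    under eq_bigr do rewrite -mulr_sumr.
    rewrite -mulr_suml -mulr_sumr; over.
  rewrite -!mulr_suml -mulr_sumr; over.
by rewrite -!mulr_suml !exprSr mul1r.
Qed.

Lemma sum_delta (R : nzRingType) (n : nat) (a : 'I_n) (g : 'I_n -> R) :
  \sum_b (a == b)%:R * g b = g a.
Proof.
rewrite (bigD1 a) //= eqxx mul1r big1 ?addr0 // => b.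
by rewrite eq_sym => /negPf ->; rewrite mul0r.
Qed.

(** The deltas identify the four indices in pairs, in three possible ways. *)
Lemma sum4_pairings (R : comNzRingType) (n : nat) (t : tensor4 R n) :
  sum4 (fun a b c d => pairings R a b c d * t a b c d) =
  \sum_a \sum_b (t a a b b + t a b a b + t a b b a).
Proof.
under eq_sum4 do rewrite !mulrDl.
rewrite !sum4D; under [RHS]eq_bigr do rewrite !big_split.
rewrite !big_split /=; congr (_ + _ + _); apply: eq_bigr => a _.
- rewrite exchange_big; apply: eq_bigr => c _ /=.
  rewrite exchange_big -[RHS]sum_delta; apply: eq_bigr => d _ /=.
  rewrite -[t a a c d](sum_delta a (fun b => t a b c d)) mulr_sumr.
  by apply: eq_bigr => b _; ring.
- apply: eq_bigr => b _; rewrite -[RHS](sum_delta a (fun c => t a b c b)).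
  apply: eq_bigr => c _; rewrite -[t a b c b](sum_delta b) mulr_sumr.
  by apply: eq_bigr => d _; ring.
- apply: eq_bigr => b _; rewrite -[RHS](sum_delta b (fun c => t a b c a)).
  apply: eq_bigr => c _; rewrite -[t a b c a](sum_delta a) mulr_sumr.
  by apply: eq_bigr => d _; ring.
Qed.

(** With [S = sum_i |x_i|^4], [G = sum_(i, j) <x_i, x_j>^4] and
    [T = sum_i x_i^(tensor 4)], one has [<T, T> = G], [<pairings, T> = 3 S] and
    [<pairings, pairings> = 3 n (n + 2)].  So [S / (n (n + 2)) pairings] is the
    projection of [T] on the line of [pairings], and the inequality is the
    positivity of the square norm of the difference. *)
Lemma fourth_moment_bound (R : numDomainType) (n : nat) (I : finType)
    (x : I -> 'I_n -> R) :
  (forall i a, x i a \is Num.real) ->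
  3%:R * (\sum_i dot (x i) (x i) ^+ 2) ^+ 2 <=
  (n * (n + 2))%:R * \sum_i \sum_j dot (x i) (x j) ^+ 4.
Proof.
move=> xR.
have [n0|n_gt0] := posnP n.
  have -> : (n * (n + 2))%:R = 0 :> R by rewrite n0.
  rewrite mul0r big1 ?expr0n ?mulr0 // => i _.
  by rewrite /dot big1 ?expr0n // => a _;
    have := leq_ltn_trans (leq0n a) (ltn_ord a); rewrite lt0n => /eqP.
pose S := \sum_i dot (x i) (x i) ^+ 2.
pose G := \sum_i \sum_j dot (x i) (x j) ^+ 4.
pose T a b c d := \sum_i x i a * x i b * x i c * x i d.
pose m : R := (n * (n + 2))%:R.
have TT : sum4 (fun a b c d => T a b c d * T a b c d) = G.
  under eq_sum4 do rewrite /T mulr_suml.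
  rewrite exchange_sum4; apply: eq_bigr => i _.
  under eq_sum4 do rewrite mulr_sumr.
  rewrite exchange_sum4; apply: eq_bigr => j _; rewrite -sum4_rank_one.
  by apply: eq_sum4 => a b c d /=; ring.
have PT : sum4 (fun a b c d => pairings R a b c d * T a b c d) = 3%:R * S.
  under eq_sum4 do rewrite /T mulr_sumr.
  rewrite exchange_sum4 mulr_sumr; apply: eq_bigr => i _.
  rewrite sum4_pairings /dot expr2 big_distrlr mulr_sumr; apply: eq_bigr => a _.
  by rewrite mulr_sumr; apply: eq_bigr => b _ /=; ring.
have PP : sum4 (fun a b c d : 'I_n => pairings R a b c d * pairings R a b c d)
    = 3%:R * m.
  rewrite sum4_pairings.
  under eq_bigr => a _.
    have E b : pairings R a a b b + pairings R a b a b + pairings R a b b a =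
       3%:R + 6%:R * ((a == b)%:R * 1).
      rewrite /pairings !eqxx (eq_sym b a).
      by case: (a == b) => /=; ring.
    under eq_bigr do rewrite E.
    rewrite big_split /= -mulr_sumr sum_delta sumr_const card_ord.
    over.
  rewrite sumr_const card_ord -[_ *+ n]mulr_natr -[3%:R *+ n]mulr_natr.
  rewrite /m natrM natrD.
  by move: (n%:R : R) => k; ring.
have m_gt0 : 0 < m by rewrite ltr0n muln_gt0 n_gt0 addn2.
(* [T - S / m pairings], cleared of its denominator *)
have sq_ge0 :
    0 <= sum4 (fun a b c d => (m * T a b c d - S * pairings R a b c d) ^+ 2).
  do 4![apply: sumr_ge0 => ? _]; apply: real_exprn_even_ge0 => //.
  have dotR i : dot (x i) (x i) \is Num.real.
    by apply: rpred_sum => a _; apply: rpredM.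
  apply: rpredB; apply: rpredM.
  - exact: rpred_nat.
  - by apply: rpred_sum => i _; rewrite !rpredM.
  - by apply: rpred_sum => i _; rewrite rpredX.
  - by rewrite /pairings !rpredD // !rpredM // rpred_nat.
change (3%:R * S ^+ 2 <= m * G); clearbody S G T m.
suff expand :
    sum4 (fun a b c d => (m * T a b c d - S * pairings R a b c d) ^+ 2)
    = m * (m * G - 3%:R * S ^+ 2).
  by move: sq_ge0; rewrite expand pmulr_rge0 // subr_ge0.
rewrite (_ : m * (m * G - _) = m ^+ 2 * G
    + ((- (m * S *+ 2)) * (3%:R * S) + S ^+ 2 * (3%:R * m))); last by ring.
rewrite -TT -PT -PP -!sum4Z -!sum4D.
by apply: eq_sum4 => a b c d; ring.
Qed.

(** * A bound for mutually unbiased frames *)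

Section Frames.
Variables (C : numClosedFieldType) (n w : nat).
Hypothesis w_gt0 : (0 < w)%N.
Implicit Types H K L W : 'M[C]_n.

Lemma mulmx_adjE H K i j : (H *m K ^t*) i j = \sum_a H i a * (K j a)^*.
Proof. by rewrite mxE; apply: eq_bigr => a _; rewrite !mxE. Qed.

Lemma unit_weighing_adj W : unit_weighing w W -> unit_weighing w (W ^t*).
Proof.
case=> Wabs WW; split=> [i j|]; first by rewrite !mxE norm_conjC.
have w_neq0 : w%:R != 0 :> C by rewrite pnatr_eq0 -lt0n.
have /mulmx1C E : W *m (w%:R^-1 *: W ^t*) = 1%:M.
  by rewrite -scalemxAr WW scale_scalar_mx mulVf.
rewrite trmxCK -[LHS]scale1r -{1}(mulfV w_neq0) -scalerA scalemxAl E.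
by rewrite scalemx1.
Qed.

Lemma unbiased_sym H K : unbiased w H K -> unbiased w K H.
Proof.
move=> [L [Lw HK]]; exists (L ^t*); split; first exact: unit_weighing_adj.
rewrite -[K]trmxCK -map_mxM -trmx_mul HK linearZ /= map_mxZ /=.
by rewrite conj_Creal ?ger0_real ?sqrtC_ge0 ?ler0n.
Qed.

(** For the basis [sqrt w e_i], the weighing matrix that witnesses unbiasedness
    is [W] itself. *)
Lemma unbiased_basis W : unit_weighing w W -> unbiased w W (sqrtC w%:R)%:M.
Proof.
exists W; split=> //; rewrite tr_scalar_mx map_scalar_mx /=.
by rewrite conj_Creal ?ger0_real ?sqrtC_ge0 ?ler0n // mul_mx_scalar.
Qed.

(** The entries of [H K^*] are [sqrt w] times numbers [l] of absolute value 0 or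
    1, for which [|l|^4 = |l|^2]; and the rows of a weighing matrix have square
    norm [w]. *)
Lemma unbiased_sum4 H K :
    (forall i a, H i a \is Num.real) -> (forall i a, K i a \is Num.real) ->
  unbiased w H K ->
  \sum_i \sum_j (H *m K ^t*) i j ^+ 4 = (n * w ^ 3)%:R.
Proof.
move=> HR KR [L [[Labs LL] HK]].
have absE i j : (H *m K ^t*) i j ^+ 4 = w%:R ^+ 2 * (L i j * (L i j)^*).
  have gR : (H *m K ^t*) i j \is Num.real.
    rewrite mulmx_adjE; apply: rpred_sum => a _.
    by rewrite rpredM // conj_Creal.
  rewrite -[LHS]ger0_norm ?real_exprn_even_ge0 // normrX HK mxE normrM.
  rewrite exprMn ger0_norm ?sqrtC_ge0 ?ler0n // (exprM _ 2 2) sqrtCK -normCK.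
  by congr (_ * _); case: (Labs i j) => ->; rewrite ?expr0n ?expr1n.
rewrite (eq_bigr (fun=> (w ^ 3)%:R)) => [|i _].
  by rewrite sumr_const card_ord natrM mulr_natl.
under eq_bigr do rewrite absE.
rewrite -mulr_sumr -mulmx_adjE LL mxE eqxx mulr1n -natrX -natrM.
by rewrite -expnSr.
Qed.

Lemma weighing_sum4 H : H *m H ^t* = w%:R%:M ->
  \sum_i \sum_j (H *m H ^t*) i j ^+ 4 = (n * w ^ 4)%:R.
Proof.
move=> ->; rewrite (eq_bigr (fun=> (w ^ 4)%:R)) => [|i _].
  by rewrite sumr_const card_ord natrM mulr_natl.
rewrite (bigD1 i) //= mxE eqxx mulr1n natrX big1 ?addr0 // => j.
by rewrite mxE eq_sym => /negPf ->; rewrite mulr0n expr0n.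
Qed.

(** The fourth-moment inequality for all the rows of all the matrices.  The
    entries of [F a] are not restricted to 0, 1 and -1, so that the family may
    contain a scalar matrix. *)
Lemma frame_bound (J : finType) (F : J -> 'M[C]_n) :
    (0 < n)%N -> (0 < #|J|)%N ->
    (forall a i j, F a i j \is Num.real) ->
    (forall a, F a *m F a ^t* = w%:R%:M) ->
    (forall a b, a != b -> unbiased w (F a) (F b)) ->
  (3 * w * #|J| <= (n + 2) * (w + #|J|.-1))%N.
Proof.
move=> n_gt0 J_gt0 FR FF FU.
pose x (p : J * 'I_n) := F p.1 p.2.
have dotE p q : dot (x p) (x q) = (F p.1 *m F q.1 ^t*) p.2 q.2.
  by rewrite mulmx_adjE; apply: eq_bigr => a _; rewrite conj_Creal.
have xR p a : x p a \is Num.real by apply: FR.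
have := fourth_moment_bound xR.
have -> : \sum_p dot (x p) (x p) ^+ 2 = (#|J| * n * w ^ 2)%:R.
  rewrite (eq_bigr (fun=> (w ^ 2)%:R)) => [|p _].
    by rewrite sumr_const card_prod card_ord natrM mulr_natl.
  by rewrite dotE FF mxE eqxx natrX.
have -> : \sum_p \sum_q dot (x p) (x q) ^+ 4
    = (#|J| * (n * w ^ 3 * (w + #|J|.-1)))%:R.
  transitivity (\sum_a \sum_b \sum_i \sum_j (F a *m F b ^t*) i j ^+ 4).
    under eq_bigr do under eq_bigr do rewrite dotE.
    rewrite -(pair_bigA _ (fun a i => \sum_q (F a *m F q.1 ^t*) i q.2 ^+ 4)) /=.
    apply: eq_bigr => a _; rewrite exchange_big /=.
    rewrite -(pair_bigA _ (fun b j => \sum_i (F a *m F b ^t*) i j ^+ 4)) /=.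
    by apply: eq_bigr => b _; rewrite exchange_big.
  rewrite (eq_bigr (fun=> (n * w ^ 3 * (w + #|J|.-1))%:R)) => [|a _].
    by rewrite sumr_const -mulrnA mulnC.
  rewrite (bigD1 a) //= weighing_sum4 //.
  rewrite (eq_bigr (fun=> (n * w ^ 3)%:R)) => [|b ba].
    rewrite sumr_const cardC1 -mulrnA -natrD; congr _%:R.
    by rewrite (expnSr w 3) mulnA mulnDr.
  by apply: unbiased_sum4 => //; apply: FU; rewrite eq_sym.
rewrite -!natrX -!natrM ler_nat.
rewrite (_ : 3 * _ = #|J| * n ^ 2 * w ^ 3 * (3 * w * #|J|))%N; last by ring.
rewrite (_ : _ * (n + 2) * _
  = #|J| * n ^ 2 * w ^ 3 * ((n + 2) * (w + #|J|.-1)))%N; last by ring.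
by rewrite leq_pmul2l // !muln_gt0 J_gt0 n_gt0 w_gt0.
Qed.

(** Adding the basis [sqrt w e_i] to the family is what improves the bound of
    [frame_bound] by one: it counts as a frame, but not as a weighing matrix. *)
Lemma add_basis_bound (J : finType) (F : J -> 'M[C]_n) :
    (0 < n)%N ->
    (forall a, real_weighing w (F a)) ->
    (forall a b, a != b -> unbiased w (F a) (F b)) ->
  (3 * w * #|J|.+1 <= (n + 2) * (w + #|J|))%N.
Proof.
move=> n_gt0 FW FU.
pose G (o : option J) := if o is Some a then F a else (sqrtC w%:R)%:M.
have rtR : sqrtC w%:R \is @Num.real C by rewrite ger0_real ?sqrtC_ge0 ?ler0n.
have := @frame_bound _ G n_gt0; rewrite card_option; apply=> //.
- move=> [a|] i j /=; last by rewrite mxE rpredMn.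
  by case: (FW a) => _ /(_ i j) [] ->; rewrite ?rpredN ?rpred0 ?rpred1.
- move=> [a|]; first by case: (FW a) => [[]].
  rewrite tr_scalar_mx map_scalar_mx /= conj_Creal // mul_scalar_mx.
  by rewrite scale_scalar_mx -expr2 sqrtCK.
- move=> [a|] [b|] //= ab; first exact: FU.
    by apply: unbiased_basis; case: (FW a).
  by apply/unbiased_sym/unbiased_basis; case: (FW b).
Qed.

(** [L = H K^* / sqrt w] satisfies [L L^* = w I] automatically, so only the
    absolute values of its entries have to be checked. *)
Lemma unbiased_of_entries H K :
    unit_weighing w H -> unit_weighing w K ->
    (forall i j, `|(H *m K ^t*) i j| = 0 \/ `|(H *m K ^t*) i j| = sqrtC w%:R) ->
  unbiased w H K.
Proof.
move=> [_ HH] /unit_weighing_adj[_]; rewrite trmxCK => KK HK.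
have rt_neq0 : sqrtC w%:R != 0 :> C by rewrite sqrtC_eq0 pnatr_eq0 -lt0n.
have rtJ : (sqrtC w%:R)^-1^* = (sqrtC w%:R)^-1 :> C.
  by rewrite conj_Creal ?rpredV ?ger0_real ?sqrtC_ge0 ?ler0n.
exists ((sqrtC w%:R)^-1 *: (H *m K ^t*)).
split; last by rewrite scalerA mulfV // scale1r.
split=> [i j|].
  rewrite mxE normrM normfV [X in X^-1 * _]ger0_norm ?sqrtC_ge0 ?ler0n //.
  by case: (HK i j) => ->; [left; rewrite mulr0 | right; rewrite mulVf].
rewrite linearZ /= map_mxZ /= rtJ trmx_mul map_mxM trmxCK.
rewrite -scalemxAl -scalemxAr scalerA mulmxA -(mulmxA H) KK mul_mx_scalar.
rewrite -scalemxAl HH scalerA -invfM -expr2 sqrtCK.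
by rewrite mulVf ?scale1r // pnatr_eq0 -lt0n.
Qed.

End Frames.

Lemma mutually_unbiased_real_bound (C : numClosedFieldType) (n w : nat)
    (S : set 'M[C]_n) :
  (0 < n)%N -> (0 < w)%N -> mutually_unbiased_real w S ->
  forall B : {fset 'M[C]_n}, [set` B] `<=` S ->
  (3 * w * #|` B|.+1 <= (n + 2) * (w + #|` B|))%N.
Proof.
move=> n_gt0 w_gt0 [SW SU] B BS; rewrite cardfE.
apply: (add_basis_bound w_gt0 (F := fun M : B => val M)) => // [M|M N MN].
  by apply/SW/BS => /=; apply: fsvalP.
apply: SU; [by apply/BS => /=; apply: fsvalP ..|].
by move=> /val_inj/eqP; apply/negP.
Qed.

(** The bound on finite subsets also excludes that [S] is infinite. *)
Lemma card_le_fset (T : choiceType) (S : set T) (m : nat) :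
  (forall B : {fset T}, [set` B] `<=` S -> (#|` B| <= m)%N) -> S #<= `I_m.
Proof.
move=> Sm; have [Sfin|/infinite_set_fset] := pselect (finite_set S).
  have /finite_setP[k Sk] := Sfin.
  by rewrite (card_le_eql Sk) card_le_II -(card_fset_set Sk) Sm // fset_setK.
by move=> /(_ m.+1)[B /Sm]; rewrite leqNgt => /negP.
Qed.

(** * Fourteen mutually unbiased matrices in the E8 root system *)

(** The planes through 0 in F_2^3, a point being the number with its three
    coordinates as binary digits. *)
Definition planes : seq (seq nat) :=
  [:: [:: 0; 1; 2; 3]; [:: 0; 1; 4; 5]; [:: 0; 1; 6; 7]; [:: 0; 2; 4; 6];
      [:: 0; 2; 5; 7]; [:: 0; 3; 4; 7]; [:: 0; 3; 5; 6]]%N.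

Definition even_signs : seq (seq int) :=
  [:: [:: 1; 1; 1; 1]; [:: 1; 1; -1; -1]; [:: 1; -1; 1; -1]; [:: 1; -1; -1; 1]].

Definition odd_signs : seq (seq int) :=
  [:: [:: -1; 1; 1; 1]; [:: 1; -1; 1; 1]; [:: 1; 1; -1; 1]; [:: 1; 1; 1; -1]].

(** The first four rows of matrix [k] are supported on a plane through 0 and the
    last four on the parallel plane; [index j block] is 4 for a point [j]
    outside of the block, where the default value of [nth] gives the entry 0. *)
Definition e8_entry (k i j : nat) : int :=
  let P := nth [::] planes k./2 in
  let block := if (i < 4)%N then P else [seq x <- iota 0 8 | x \notin P] in
  let signs := if odd k then odd_signs else even_signs in
  nth 0 (nth [::] signs (i %% 4)) (index j block).

(** Written with [foldr] rather than as a big sum, so that it computes. *)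
Definition e8_dot (k l i j : nat) : int :=
  foldr +%R 0 [seq e8_entry k i a * e8_entry l j a | a <- iota 0 8].

Lemma e8_entry_values k i j : (k < 14)%N -> (i < 8)%N -> (j < 8)%N ->
  e8_entry k i j \in [:: 0; 1; -1].
Proof.
move=> lk li lj.
have /allP/(_ k)/[!mem_iota]/(_ lk) : all (fun k => all (fun i => all (fun j =>
   e8_entry k i j \in [:: 0; 1; -1]) (iota 0 8)) (iota 0 8)) (iota 0 14).
  by vm_compute.
by move=> /allP/(_ i)/[!mem_iota]/(_ li)/allP/(_ j)/[!mem_iota]/(_ lj).
Qed.

Lemma e8_dot_values k l i j :
  (k < 14)%N -> (l < 14)%N -> (i < 8)%N -> (j < 8)%N ->
  if k == l then e8_dot k l i j = 4 *+ (i == j)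
  else e8_dot k l i j \in [:: 0; 2; -2].
Proof.
move=> lk ll li lj.
have : all (fun k => all (fun l => all (fun i => all (fun j =>
   if k == l then e8_dot k l i j == 4 *+ (i == j)
   else e8_dot k l i j \in [:: 0; 2; -2])
   (iota 0 8)) (iota 0 8)) (iota 0 14)) (iota 0 14).
  by vm_compute.
move=> /allP/(_ k)/[!mem_iota]/(_ lk)/allP/(_ l)/[!mem_iota]/(_ ll).
move=> /allP/(_ i)/[!mem_iota]/(_ li)/allP/(_ j)/[!mem_iota]/(_ lj).
by case: (k == l) => // /eqP.
Qed.

Section Construction.
Variable C : numClosedFieldType.

Definition e8_mx (k : nat) : 'M[C]_8 := \matrix_(i, j) (e8_entry k i j)%:~R.

Lemma e8_mx_mul k l i j :
  (e8_mx k *m (e8_mx l) ^t*) i j = (e8_dot k l i j)%:~R.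
Proof.
rewrite mulmx_adjE /e8_dot foldrE big_map.
rewrite -[iota 0 8]/(index_iota 0 8) big_mkord.
rewrite rmorph_sum; apply: eq_bigr => a _ /=.
by rewrite !mxE conj_Creal ?rpred_int // rmorphM.
Qed.

Lemma e8_mx_weighing k : (k < 14)%N -> real_weighing 4 (e8_mx k).
Proof.
move=> lk.
have E i j : [\/ e8_mx k i j = 0, e8_mx k i j = 1 | e8_mx k i j = -1].
  rewrite mxE; have := e8_entry_values lk (ltn_ord i) (ltn_ord j).
  by rewrite !inE => /or3P[] /eqP ->;
    [constructor 1|constructor 2|constructor 3]; rewrite ?rmorphN1.
split=> //; split=> [i j|].
  by case: (E i j) => ->; [left|right|right]; rewrite ?normr0 ?normrN ?normr1.
apply/matrixP => i j; rewrite e8_mx_mul !mxE.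
have := e8_dot_values lk lk (ltn_ord i) (ltn_ord j); rewrite eqxx => ->.
by rewrite rmorphMn.
Qed.

Lemma e8_mx_norm k l i j : (k < 14)%N -> (l < 14)%N -> k != l ->
  `|(e8_mx k *m (e8_mx l) ^t*) i j| \in [:: 0; 2].
Proof.
move=> lk ll kl; rewrite e8_mx_mul.
have := e8_dot_values lk ll (ltn_ord i) (ltn_ord j); rewrite (negPf kl) !inE.
by move=> /or3P[] /eqP ->;
  rewrite ?rmorphN ?normrN ?normr0 ?eqxx //= normr_nat eqxx orbT.
Qed.

Lemma sqrtC4 : sqrtC 4%:R = 2 :> C.
Proof. by rewrite (natrX _ 2 2) sqrCK ?ler0n. Qed.

Lemma e8_mx_unbiased k l : (k < 14)%N -> (l < 14)%N -> k != l ->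
  unbiased 4 (e8_mx k) (e8_mx l).
Proof.
move=> lk ll kl; apply: unbiased_of_entries => //.
- by case: (e8_mx_weighing lk).
- by case: (e8_mx_weighing ll).
- move=> i j; rewrite sqrtC4; have := e8_mx_norm i j lk ll kl.
  by rewrite !inE => /orP[] /eqP; [left|right].
Qed.

Lemma e8_mx_inj : {in `I_14 &, injective e8_mx}.
Proof.
move=> k l /set_mem/= lk /set_mem/= ll kl; apply/eqP/negPn/negP => neq.
have [[_ WW] _] := e8_mx_weighing lk.
have := e8_mx_norm 0 0 lk ll neq; rewrite -kl WW mxE eqxx mulr1n normr_nat.
by rewrite !inE pnatr_eq0 eqr_nat.
Qed.

End Construction.

Local Open Scope classical_set_scope.
Local Open Scope card_scope.

Theorem theorem21 (R : realType) :
  (exists S : set 'M[R[i]]_8, mutually_unbiased_real 4 S /\ S #= `I_14) /\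
  (forall S : set 'M[R[i]]_8, mutually_unbiased_real 4 S -> S #<= `I_14).
Proof.
split=> [|S SU].
  exists (e8_mx R[i] @` `I_14); split; last exact/inj_card_eq/e8_mx_inj.
  split=> [_ [k lk <-]|_ _ [k lk <-] [l ll <-] kl]; first exact: e8_mx_weighing.
  by apply: e8_mx_unbiased => //; apply/eqP => E; apply: kl; rewrite E.
apply: card_le_fset => B BS.
have := mutually_unbiased_real_bound (n := 8) (w := 4) isT isT SU BS.
move: #|` B| => N. lia.
Qed.
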